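(* Let $\alpha>0$. Given any $X^k=(h^k,Q^k)\in\widetilde\Lambda$, the projected point $$X^{k+1}=P_{\widetilde\Lambda}\big[X^k-\alpha\mathcal{F}(X^k)\big]$$ can be expressed as $X^{k+1}=(h^{k+1},Q^{k+1})$, where $$h_p^{k+1}(t)=\Big[h_p^k(t)-\alpha\Psi_p(t,h^k)+Q_{ij}^k+\alpha\Theta_{ij}[Q^k]-Q_{ij}^{k+1}\Big]_+\qquad\forall p\in\mathcal{P}_{ij},\ (i,j)\in\mathcal{W},\ \text{a.e. } t\in[t_0,t_f],$$ $$Q_{ij}^{k+1}=\sum_{p\in\mathcal{P}_{ij}}\int_{t_0}^{t_f}\Big[h_p^k(t)-\alpha\Psi_p(t,h^k)+Q_{ij}^k+\alpha\Theta_{ij}[Q^k]-Q_{ij}^{k+1}\Big]_+dt\qquad\forall (i,j)\in\mathcal{W}.$$ In addition, the $h^{k+1}$ and $Q^{k+1}$ satisfying these relations are unique.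
   Context: Fix a time interval $[t_0,t_f]$ with $t_0<t_f$, a finite set $\mathcal{W}$ of origin-destination (O-D) pairs, and a finite set $\mathcal{P}$ of paths which is the disjoint union of the sets $\mathcal{P}_{ij}$ of paths connecting O-D pair $(i,j)\in\mathcal{W}$. $[x]_+=\max\{0,x\}$. $L^2_+[t_0,t_f]$ denotes the nonnegative functions in $L^2[t_0,t_f]$. The effective path delay operator is a given map $\Psi:(L^2_+[t_0,t_f])^{|\mathcal{P}|}\to(L^2_+[t_0,t_f])^{|\mathcal{P}|}$, $\Psi(h)=(\Psi_p(\cdot,h))_{p\in\mathcal{P}}$, and the inverse demand function is a given map $\Theta=(\Theta_{ij})_{(i,j)\in\mathcal{W}}:\mathbb{R}_+^{|\mathcal{W}|}\to\mathbb{R}_{++}^{|\mathcal{W}|}$. $E=(L^2[t_0,t_f])^{|\mathcal{P}|}\times\mathbb{R}^{|\mathcal{W}|}$ is the Hilbert space with inner product $\langle(\xi,u),(\eta,v)\rangle_E=\sum_{p\in\mathcal{P}}\int_{t_0}^{t_f}\xi_p(t)\eta_p(t)\,dt+\sum_{(i,j)\in\mathcal{W}}u_{ij}v_{ij}$ and induced norm $\|\cdot\|_E$. The feasible set is the convex set $$\widetilde\Lambda=\Big\{(h,Q)\in E:\ h\ge 0,\ \sum_{p\in\mathcal{P}_{ij}}\int_{t_0}^{t_f}h_p(t)\,dt=Q_{ij}\ \ \forall (i,j)\in\mathcal{W}\Big\}.$$ The map $\mathcal{F}:\widetilde\Lambda\to E$ is $\mathcal{F}(h,Q)=(\Psi(h),\Theta^-[Q])$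 with $\Theta^-=-\Theta$. $P_{\widetilde\Lambda}[Y]=\operatorname{argmin}_{X\in\widetilde\Lambda}\|Y-X\|_E$ is the minimum-norm projection of $Y\in E$ onto $\widetilde\Lambda$. *)

(* Defs.v *)
From HB Require Import structures.
From mathcomp Require Import all_boot all_order all_algebra.
From mathcomp Require Import all_classical all_reals all_analysis.
From mathcomp Require Import measurable_realfun.

Set Implicit Arguments.
Unset Strict Implicit.
Unset Printing Implicit Defensive.

Import Order.TTheory GRing.Theory Num.Theory.
Import numFieldNormedType.Exports.

Local Open Scope classical_set_scope.
Local Open Scope ring_scope.

(* The library provides LspaceType2 mu (square-integrable functions modulo
   almost everywhere equality) without algebraic structure; the vector space
   structure is lifted here from the representatives in LfunType. *)
Section L2_lmodule.
Context d (T : measurableType d) (R : realType).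
Variable mu : {measure set T -> \bar R}.

Local Notation Lf := (LfunType mu (@lee1n R 2)).
Local Notation L2 := (LspaceType2 mu).
Local Notation mfR := {mfun T >-> measurableTypeR R}.
Local Notation Q := {mfun_ mu, T >-> measurableTypeR R}.

Definition L2_fun (f : L2) : T -> R := (f : Q).

Lemma L2_fun_Lfun (f : L2) : L2_fun f \in Lfun mu 2%:E.
Proof.
rewrite inE; apply/andP; split; rewrite inE /=.
  exact: (@measurable_funPT _ _ _ _ (repr (f : Q))).
exact: (@Lebesgue_finite _ _ _ _ _ _ f).
Qed.

Definition L2_repr (f : L2) : Lf := Lfun_Sub (lee1n 2) (L2_fun_Lfun f).

Lemma Lf_measurable (f : Lf) :
  @measurable_fun _ _ T (measurableTypeR R) [set: T] f.
Proof. exact: (@measurable_funPT _ _ _ _ f). Qed.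

Definition Lf_mfun (f : Lf) : mfR :=
  HB.pack (f : T -> measurableTypeR R)
    (isMeasurableFun.Build _ _ _ _ _ (Lf_measurable f)).

Definition Lf_class (f : Lf) : Q := \pi_(Q)%qT (Lf_mfun f).

Lemma Lf_class_ae (f : Lf) : (Lf_class f : T -> R) = f %[ae mu].
Proof.
have := reprK (Lf_class f); rewrite {2}/Lf_class => /eqmodP.
exact: asboolW.
Qed.

Lemma Lf_class_finite (f : Lf) : finite_norm mu 2%:E (Lf_class f : T -> R).
Proof.
have := Lfunction_finite _ f; rewrite /finite_norm unlock.
congr (_ < _)%E; congr (_ `^ _)%E.
have mpow (g : T -> \bar R) : measurable_fun [set: T] g ->
    measurable_fun [set: T] (fun x => `|g x| `^ 2)%E.
  move=> mg; apply: (@measurableT_comp _ _ _ _ _ _ (fun x => x `^ 2)%E) => //=.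
    exact: (measurableT_comp (measurable_poweR _)).
  exact: measurableT_comp.
apply: ge0_ae_eq_integral => //.
- apply: mpow; apply/measurable_EFinP; exact: (@measurable_funPT _ _ _ _ f).
- apply: mpow; apply/measurable_EFinP.
  exact: (@measurable_funPT _ _ _ _ (repr (Lf_class f))).
- by move=> x _; exact: poweR_ge0.
- by move=> x _; exact: poweR_ge0.
- by apply: filterS (Lf_class_ae f) => x /= /(_ I) ->.
Qed.

Definition L2_class (f : Lf) : L2 :=
  HB.pack (Lf_class f)
    (isFinLebesgue.Build _ _ _ _ _ (lee1n 2) (Lf_class f) (Lf_class_finite f)).

Lemma L2_class_ae (f : Lf) : L2_repr (L2_class f) = f %[ae mu].
Proof. exact: Lf_class_ae. Qed.

Lemma L2_reprP (f g : L2) : L2_repr f = L2_repr g %[ae mu] -> f = g.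
Proof.
case: f g => [f [[pf]]] [g [[pg]]] fg.
have {}fg : f = g.
  rewrite -[f]reprK -[g]reprK; apply/eqmodP/asboolP.
  by apply: filterS fg => x /(_ I).
by move: pf pg; rewrite fg => pf pg; rewrite (bool_irrelevance pf pg).
Qed.

Lemma L2_classP (f g : Lf) : f = g %[ae mu] -> L2_class f = L2_class g.
Proof.
move=> fg; apply: L2_reprP.
by apply: filterS3 (L2_class_ae f) (L2_class_ae g) fg => x /= + + + _ =>
  /(_ I) -> /(_ I) -> /(_ I).
Qed.

Lemma L2_reprK (f : L2) : L2_class (L2_repr f) = f.
Proof. exact/L2_reprP/L2_class_ae. Qed.

Definition L2_zero : L2 := L2_class 0.
Definition L2_opp (f : L2) : L2 := L2_class (- L2_repr f).
Definition L2_add (f g : L2) : L2 := L2_class (L2_repr f + L2_repr g).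
Definition L2_scale (a : R) (f : L2) : L2 := L2_class (a *: L2_repr f).

Lemma L2_class_opp (f : Lf) : L2_opp (L2_class f) = L2_class (- f).
Proof.
apply: L2_classP; apply: filterS (L2_class_ae f) => x /= + _ => /(_ I) fE.
by congr (- _).
Qed.

Lemma L2_class_add (f g : Lf) :
  L2_add (L2_class f) (L2_class g) = L2_class (f + g).
Proof.
apply: L2_classP.
apply: filterS2 (L2_class_ae f) (L2_class_ae g) => x /= + + _.
by move=> /(_ I) fE /(_ I) gE; congr (_ + _).
Qed.

Lemma L2_class_scale a (f : Lf) : L2_scale a (L2_class f) = L2_class (a *: f).
Proof.
apply: L2_classP; apply: filterS (L2_class_ae f) => x /= + _ => /(_ I) fE.
by congr (_ * _).
Qed.

Lemma L2_ind (P : L2 -> Prop) : (forall f, P (L2_class f)) -> forall f, P f.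
Proof. by move=> Pf f; rewrite -(L2_reprK f). Qed.

Lemma L2_addA : associative L2_add.
Proof.
by do 3![elim/L2_ind => ?]; rewrite !L2_class_add addrA.
Qed.

Lemma L2_addC : commutative L2_add.
Proof. by do 2![elim/L2_ind => ?]; rewrite !L2_class_add addrC. Qed.

Lemma L2_add0 : left_id L2_zero L2_add.
Proof. by elim/L2_ind => ?; rewrite L2_class_add add0r. Qed.

Lemma L2_addN : left_inverse L2_zero L2_opp L2_add.
Proof. by elim/L2_ind => ?; rewrite L2_class_opp L2_class_add addNr. Qed.

HB.instance Definition _ := gen_eqMixin L2.
HB.instance Definition _ := gen_choiceMixin L2.
HB.instance Definition _ :=
  GRing.isZmodule.Build L2 L2_addA L2_addC L2_add0 L2_addN.

Lemma L2_addE (f g : L2) : f + g = L2_add f g. Proof. by []. Qed.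

Lemma L2_scaleA a b f : L2_scale a (L2_scale b f) = L2_scale (a * b) f.
Proof. by elim/L2_ind: f => f; rewrite !L2_class_scale scalerA. Qed.

Lemma L2_scale1 : left_id 1 L2_scale.
Proof. by elim/L2_ind => f; rewrite L2_class_scale scale1r. Qed.

Lemma L2_scaleDr : right_distributive L2_scale +%R.
Proof.
move=> a; do 2![elim/L2_ind => ?].
by rewrite !L2_addE !(L2_class_scale, L2_class_add) scalerDr.
Qed.

Lemma L2_scaleDl f : {morph L2_scale^~ f : a b / a + b}.
Proof.
move=> a b /=; elim/L2_ind: f => f.
by rewrite !L2_addE !(L2_class_scale, L2_class_add) scalerDl.
Qed.

HB.instance Definition _ := GRing.Zmodule_isLmodule.Build R L2
  L2_scaleA L2_scale1 L2_scaleDr L2_scaleDl.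

Lemma L2_funD (f g : L2) : L2_fun (f + g) = L2_fun f \+ L2_fun g %[ae mu].
Proof. exact: L2_class_ae. Qed.

Lemma L2_funZ a (f : L2) : L2_fun (a *: f) = a \*: L2_fun f %[ae mu].
Proof. exact: L2_class_ae. Qed.

End L2_lmodule.

Definition lebesgue_itv (R : realType) (t0 tf : R) :
    {measure set (measurableTypeR R) -> \bar R} :=
  mrestr (@lebesgue_measure R) (measurable_itv `[t0, tf]).

Definition L2_itv (R : realType) (t0 tf : R) :=
  LspaceType2 (lebesgue_itv t0 tf).
HB.instance Definition _ (R : realType) (t0 tf : R) :=
  GRing.Lmodule.on (L2_itv t0 tf).

(* A measurable representative: only its almost everywhere class matters. *)
Definition L2_itv_fun (R : realType) (t0 tf : R) (f : L2_itv t0 tf) : R -> R :=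
  L2_fun f.
Coercion L2_itv_fun : L2_itv >-> Funclass.

Section traffic.
Context {R : realType} {t0 tf : R} {P W : finType}.

Local Notation L2 := (L2_itv t0 tf).
Local Notation mu := (lebesgue_itv t0 tf).
Local Notation E := ({ffun P -> L2} * {ffun W -> R})%type.

Definition inner_E (X Y : E) : R :=
  \sum_(p : P) \int[mu]_t (X.1 p t * Y.1 p t) + \sum_(w : W) X.2 w * Y.2 w.

Definition norm_E (X : E) : R := Num.sqrt (inner_E X X).

Definition proj_argmin (A : set E) (Y : E) : set E :=
  [set X : E | A X /\ forall Z, A Z -> norm_E (Y - X) <= norm_E (Y - Z)].

Definition L2_nneg : set {ffun P -> L2} :=
  [set h : {ffun P -> L2} | forall p, {ae mu, forall t, 0 <= h p t}].

(* The set of paths is the disjoint union of the path sets of the O-D pairs: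
   this is encoded by the map [od] sending a path to the pair it connects. *)
Definition paths (od : P -> W) (w : W) : {set P} := [set p | od p == w]%SET.

Definition feasible (od : P -> W) : set E :=
  [set X : E | L2_nneg X.1 /\
    forall w, \sum_(p in paths od w) \int[mu]_t X.1 p t = X.2 w].

Definition F_E (Psi : {ffun P -> L2} -> {ffun P -> L2})
    (Theta : {ffun W -> R} -> {ffun W -> R}) (X : E) : E :=
  (Psi X.1, - Theta X.2).

Definition update_rel (od : P -> W) (Psi : {ffun P -> L2} -> {ffun P -> L2})
    (Theta : {ffun W -> R} -> {ffun W -> R}) (alpha : R) (X Y : E) : Prop :=
  let: (h, Q) := X in
  let: (h', Q') := Y in
  let phi w p t :=
    Num.max 0 (h p t - alpha * Psi h p t + Q w + alpha * Theta Q w - Q' w) in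
  (forall w p, p \in paths od w -> {ae mu, forall t, h' p t = phi w p t}) /\
  (forall w, Q' w = \sum_(p in paths od w) \int[mu]_t phi w p t).

End traffic.

(* Main.v *)
Require Import Defs.
From mathcomp Require Import all_boot all_order all_algebra.
From mathcomp Require Import all_classical all_reals all_analysis.
From mathcomp Require Import measurable_realfun ring lra.
Set Implicit Arguments.
Unset Strict Implicit.
Unset Printing Implicit Defensive.
Import Order.TTheory GRing.Theory Num.Theory.
Import numFieldNormedType.Exports.
Local Open Scope classical_set_scope.
Local Open Scope ring_scope.

(** Let Y = (a, b) be the point to be projected, so a = h - alpha Psi(h) and
    b = Q + alpha Theta(Q).  In the system to be solved the O-D pairs interact
    only through the data: for each pair w, it asks for a number q = Q'_w such
    that q = G_w(q), where G_w(c) is the sum over the paths p of w of the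
    integrals of [a_p + b_w - c]_+; the flows are then read off from q.

    Existence and uniqueness of q.  G_w is nonnegative, nonincreasing and
    Lipschitz (the time interval has finite measure and the positive part is
    1-Lipschitz), so c - G_w(c) is continuous, strictly increasing, nonpositive
    at 0 and nonnegative at G_w(0); the intermediate value theorem gives its
    unique zero ([path_flow_fixpoint], [fixpoint_nonincreasing_unique]).  Hence
    the system has exactly one solution X = (x, q), and X is feasible.

    X is the projection.  Since x_p = [a_p + b_w - q_w]_+, a case analysis on
    the sign of a_p + b_w - q_w shows, for every z >= 0,
      (a_p - z)^2 >= (a_p - x_p)^2 + (z - x_p)^2 + 2 (b_w - q_w) (z - x_p).
    This is integrated over time with z = Z_p and summed over the paths.  If Z
    is feasible, the linear term becomes the sum over w of
    2 (b_w - q_w) (Z_w - q_w), by conservation of flow, and this is exactly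
    what is needed to complete the squares in the demand coordinates.  The
    result is the Pythagorean inequality [clipped_sqr_dist]
      |Y - X|^2 + |Z - X|^2 <= |Y - Z|^2,
    which gives both the minimality of X and its uniqueness as a minimizer.  Up
    to sign, b_w - q_w is the Lagrange multiplier of the flow constraint of w;
    having it explicitly is what makes this direct verification possible. *)

(** * Fixed points of nonincreasing real functions *)

Lemma lipschitz_maxr0 (R : realDomainType) (x y : R) :
  `|Num.max 0 x - Num.max 0 y| <= `|x - y|.
Proof.
case: (leP 0 x) => x0; case: (leP 0 y) => y0.
- by [].
- by rewrite subr0 !ger0_norm; lra.
- by rewrite sub0r normrN (ger0_norm y0) ler0_norm; lra.
- by rewrite subrr normr0.
Qed.

(** The zero of c - G c is bracketed by 0 and G 0: since 0 <= G 0 and G is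
    nonincreasing, G (G 0) <= G 0. *)
Lemma exists_fixpoint_nonincreasing_lipschitz (R : realType) (G : R -> R)
    (K : R) :
  0 <= G 0 -> {homo G : c d / c <= d >-> d <= c} ->
  (forall c d, `|G c - G d| <= K * `|c - d|) -> exists c, G c = c.
Proof.
move=> G0 Gni GK.
have Gcont : continuous G.
  move=> c; apply/cvgrPdist_le => e e0.
  (* K need not be positive, hence the modulus e / (|K| + 1). *)
  have K0 : 0 < `|K| + 1 by rewrite ltr_wpDl.
  near=> d; rewrite (le_trans (GK _ _))//.
  rewrite (@le_trans _ _ ((`|K| + 1) * `|c - d|))//.
    by rewrite ler_wpM2r// (le_trans (ler_norm K))// lerDl.
  rewrite -ler_pdivlMl// mulrC; near: d.
  by apply: cvgr_dist_le => //; rewrite divr_gt0.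
have [||c _ Hc] := @IVT R (fun c => c - G c) 0 (G 0) 0 G0.
- apply: continuous_subspaceT => c.
  by apply: cvgB; [exact: cvg_id|exact: Gcont].
- have := Gni _ _ G0 => GG.
  by rewrite ge_min le_max sub0r oppr_le0 G0 subr_ge0 GG orbT.
by exists c; apply/eqP; rewrite eq_sym -subr_eq0 Hc.
Unshelve. all: by end_near. Qed.

Lemma fixpoint_nonincreasing_unique (R : realDomainType) (G : R -> R)
    (c d : R) :
  {homo G : c d / c <= d >-> d <= c} -> G c = c -> G d = d -> c = d.
Proof.
move=> Gni Gc Gd; case: (ltgtP c d) => // cd.
  by have := Gni _ _ (ltW cd); lra.
by have := Gni _ _ (ltW cd); lra.
Qed.

(** * Integrals and almost everywhere relations *)

Section almost_everywhere_Rintegral.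
Context d (T : measurableType d) (R : realType).
Variable mu : {measure set T -> \bar R}.
Implicit Types f g : T -> R.

Lemma ae_eq_Rintegral f g :
  measurable_fun [set: T] f -> measurable_fun [set: T] g ->
  {ae mu, forall t, f t = g t} -> \int[mu]_t f t = \int[mu]_t g t.
Proof.
move=> mf mg fg; congr fine; apply: ae_eq_integral => //.
- exact/measurable_EFinP.
- exact/measurable_EFinP.
- by apply: filterS fg => t fg _; rewrite fg.
Qed.

(** The difference g - f agrees almost everywhere with its absolute value, whose
    integral is nonnegative: this reduces to a pointwise inequality. *)
Lemma ae_le_Rintegral f g :
  mu.-integrable setT (EFin \o f) -> mu.-integrable setT (EFin \o g) ->
  {ae mu, forall t, f t <= g t} -> \int[mu]_t f t <= \int[mu]_t g t.
Proof.
move=> intf intg fg; rewrite -subr_ge0 -RintegralB//.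
have mf := (measurable_EFinP _ _).1 (measurable_int _ intf).
have mg := (measurable_EFinP _ _).1 (measurable_int _ intg).
rewrite (@ae_eq_Rintegral _ (fun t => `|g t - f t|)).
- exact: Rintegral_ge0.
- exact: measurable_funB.
- by apply: measurableT_comp => //; exact: measurable_funB.
- by apply: filterS fg => t fg; rewrite ger0_norm// subr_ge0.
Qed.

Lemma Rintegral_ge0_eq0_ae f :
  mu.-integrable setT (EFin \o f) -> (forall t, 0 <= f t) ->
  \int[mu]_t f t = 0 -> {ae mu, forall t, f t = 0}.
Proof.
move=> intf f0 If0.
have mf := measurable_int _ intf.
have /(ae_eq_integral_abs mu measurableT mf) :
    (\int[mu]_t `|(EFin \o f) t| = 0)%E.
  under eq_integral do rewrite /= ger0_norm//.
  rewrite -(fineK (integrable_fin_num measurableT intf)) /=.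
  by rewrite -[fine _]/(\int[mu]_t f t) If0.
by apply: filterS => t /(_ I) [].
Qed.

Lemma Lfun_normr (p : R) f :
  f \in Lfun mu p%:E -> (fun t => `|f t|) \in Lfun mu p%:E.
Proof.
case/andP; rewrite !inE/= => mf finf; apply/andP; split.
  by rewrite inE/=; exact: measurableT_comp.
rewrite inE/= /finite_norm.
rewrite (_ : EFin \o _ = (fun t => `|(EFin \o f) t|)%E)//.
by rewrite Lnorm_abse.
Qed.

Lemma Lfun2_maxr0 f :
  f \in Lfun mu 2%:E -> (fun t => Num.max 0 (f t)) \in Lfun mu 2%:E.
Proof.
move=> Lf.
have -> : (fun t => Num.max 0 (f t)) = 2^-1 \o* (f + (fun t => `|f t|)).
  apply/funext => t; rewrite -[RHS]/((f t + `|f t|) * 2^-1).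
  case: (leP 0 (f t)) => f0; first by rewrite ger0_norm//; lra.
  by rewrite ltr0_norm//; lra.
apply: Lfun_scale; first exact: ler1n.
by apply: (Lfun_addr_closed mu (lee1n 2)).2 => //; exact: Lfun_normr.
Qed.

Lemma Lfun2_sub f g :
  f \in Lfun mu 2%:E -> g \in Lfun mu 2%:E -> f - g \in Lfun mu 2%:E.
Proof.
move=> Lf Lg; apply: (Lfun_addr_closed mu (lee1n 2)).2 => //.
exact: Lfun_oppr_closed.
Qed.

Lemma Lfun2_measurable f : f \in Lfun mu 2%:E -> measurable_fun [set: T] f.
Proof. by case/andP; rewrite inE. Qed.

End almost_everywhere_Rintegral.

(** * The integral of the excess over a level *)

Section finite_measure_excess.
Context d (T : measurableType d) (R : realType).
Variable mu : {measure set T -> \bar R}.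
Hypothesis mu_fin : fin_num_fun mu.
Implicit Types f g : T -> R.

Lemma Lfun2_cst c : cst c \in Lfun mu 2%:E.
Proof.
rewrite inE; apply/andP; split; rewrite inE//=.
rewrite /finite_norm unlock poweR_lty//.
rewrite [X in (X < _)%E](integral_cst mu measurableT (`|c| `^ 2)%:E).
rewrite lte_mul_pinfty ?lee_fin ?powR_ge0//.
by rewrite ltey_eq mu_fin.
Qed.

Lemma Lfun2_integrable f :
  f \in Lfun mu 2%:E -> mu.-integrable setT (EFin \o f).
Proof.
by move=> Lf; apply/Lfun1_integrable/Lfun_subset12 => //; exact: mu_fin.
Qed.

Lemma Lfun2_excess f c :
  f \in Lfun mu 2%:E -> (fun t => Num.max 0 (f t - c)) \in Lfun mu 2%:E.
Proof.
by move=> Lf; apply/Lfun2_maxr0/(Lfun2_sub Lf); exact: Lfun2_cst.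
Qed.

Lemma Rintegral_excess_le f : f \in Lfun mu 2%:E ->
  {homo (fun c => \int[mu]_t Num.max 0 (f t - c)) : c e / c <= e >-> e <= c}.
Proof.
move=> Lf c e ce; apply: le_Rintegral => //.
- exact/Lfun2_integrable/Lfun2_excess.
- exact/Lfun2_integrable/Lfun2_excess.
- by move=> t _; rewrite ge_max !le_max lexx lerB// orbT.
Qed.

Lemma Rintegral_excess_lipschitz f c e : f \in Lfun mu 2%:E ->
  `|\int[mu]_t Num.max 0 (f t - c) - \int[mu]_t Num.max 0 (f t - e)|
    <= fine (mu setT) * `|c - e|.
Proof.
move=> Lf; have intE c' := Lfun2_integrable (Lfun2_excess c' Lf).
rewrite -RintegralB// (le_trans (le_normr_Rintegral _ _))//.
  exact: (integrableB measurableT (intE c) (intE e)).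
rewrite mulrC -Rintegral_cst//; apply: le_Rintegral => //.
- apply: (integrable_abse (f := EFin \o _)).
  exact: (integrableB measurableT (intE c) (intE e)).
- exact/Lfun2_integrable/Lfun2_cst.
- move=> t _; rewrite (le_trans (lipschitz_maxr0 _ _))//.
  by rewrite (_ : f t - c - (f t - e) = e - c) ?[`|e - c|]distrC//; ring.
Qed.

End finite_measure_excess.

(** * Representatives of square-integrable classes *)

Section L2_pointwise.
Context d (T : measurableType d) (R : realType).
Variable mu : {measure set T -> \bar R}.
Implicit Types f g : LspaceType2 mu.

Lemma L2_funB f g :
  {ae mu, forall t, L2_fun (f - g) t = L2_fun f t - L2_fun g t}.
Proof.
rewrite -scaleN1r.
apply: filterS2 (L2_funD f (-1 *: g)) (L2_funZ (-1) g) => t + + /=.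
by move=> /(_ I) -> /(_ I) /= ->; rewrite scaleN1r.
Qed.

Lemma L2_fun_inj f g : {ae mu, forall t, L2_fun f t = L2_fun g t} -> f = g.
Proof. by move=> fg; apply: L2_reprP; apply: filterS fg => t fg _. Qed.

Lemma exists_L2_fun (u : T -> R) :
  u \in Lfun mu 2%:E ->
  exists f : LspaceType2 mu, {ae mu, forall t, L2_fun f t = u t}.
Proof.
move=> Lu; exists (L2_class (Lfun_Sub (lee1n 2) Lu)).
by apply: filterS (L2_class_ae (Lfun_Sub (lee1n 2) Lu)) => t /(_ I).
Qed.

(** Definiteness of the L^2 norm. *)
Lemma Rintegral_sqr_sub_eq0 f g :
  \int[mu]_t (L2_fun f t - L2_fun g t) ^+ 2 = 0 -> f = g.
Proof.
move=> fg0; apply: L2_fun_inj.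
have := Rintegral_ge0_eq0_ae (Lfun2_integrable_sqr
  (Lfun2_sub (L2_fun_Lfun f) (L2_fun_Lfun g))) (fun=> sqr_ge0 _) fg0.
by apply: filterS => t /eqP; rewrite sqrf_eq0 => /eqP /subr0_eq.
Qed.

End L2_pointwise.

Section restricted_lebesgue.
Context (R : realType) (t0 tf : R).

Lemma lebesgue_itv_finite : fin_num_fun (lebesgue_itv t0 tf).
Proof.
apply: lty_fin_num_fun.
rewrite [X in (X < _)%E](_ : _ = lebesgue_measure `[t0, tf]); last first.
  by rewrite /lebesgue_itv /= /mrestr setTI.
by rewrite lebesgue_measure_itv/=; case: ifP => _; rewrite ltry.
Qed.

End restricted_lebesgue.

(** * A Pythagorean inequality for clipped flows *)

(** The difference of the two sides is -2 (a + s - x) (z - x).  Either x = a + s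
    and this vanishes, or a + s < 0, x = 0 and it equals -2 (a + s) z >= 0. *)
Lemma sqr_dist_maxr0 (R : realDomainType) (a s z : R) (x := Num.max 0 (a + s)) :
  0 <= z -> (a - x) ^+ 2 + (z - x) ^+ 2 + 2 * s * (z - x) <= (a - z) ^+ 2.
Proof.
move=> z0; have : (a + s - x) * (z - x) <= 0.
  rewrite /x; case: (leP 0 (a + s)) => as0; first by rewrite subrr mul0r.
  by rewrite !subr0 mulr_le0_ge0// ltW.
by nra.
Qed.

(** The linear term makes sense because L^2 is contained in L^1 when mu is
    finite. *)
Lemma L2_sqr_dist_maxr0 d (T : measurableType d) (R : realType)
    (mu : {measure set T -> \bar R}) (mu_fin : fin_num_fun mu)
    (a x z : LspaceType2 mu) (s : R) :
  {ae mu, forall t, L2_fun x t = Num.max 0 (L2_fun a t + s)} ->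
  {ae mu, forall t, 0 <= L2_fun z t} ->
  \int[mu]_t (L2_fun a t - L2_fun x t) ^+ 2
  + \int[mu]_t (L2_fun z t - L2_fun x t) ^+ 2
  + 2 * s * (\int[mu]_t L2_fun z t - \int[mu]_t L2_fun x t)
  <= \int[mu]_t (L2_fun a t - L2_fun z t) ^+ 2.
Proof.
move=> xE z0.
have isqr (f g : LspaceType2 mu) :
    mu.-integrable setT (EFin \o (fun t => (L2_fun f t - L2_fun g t) ^+ 2)).
  exact: (Lfun2_integrable_sqr (Lfun2_sub (L2_fun_Lfun f) (L2_fun_Lfun g))).
have izx : mu.-integrable setT (EFin \o (fun t => L2_fun z t - L2_fun x t)).
  exact: (Lfun2_integrable mu_fin (Lfun2_sub (L2_fun_Lfun z) (L2_fun_Lfun x))).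
have iszx : mu.-integrable setT
    (EFin \o (fun t => 2 * s * (L2_fun z t - L2_fun x t))).
  exact: (integrableZl measurableT (2 * s) izx).
have isq2 : mu.-integrable setT (EFin \o (fun t =>
    (L2_fun a t - L2_fun x t) ^+ 2 + (L2_fun z t - L2_fun x t) ^+ 2)).
  exact: (integrableD measurableT (isqr a x) (isqr z x)).
rewrite -RintegralB//; [|exact/(Lfun2_integrable mu_fin)/L2_fun_Lfun..].
rewrite -RintegralZl// -!RintegralD//.
apply: ae_le_Rintegral => //.
  exact: (integrableD measurableT isq2 iszx).
by apply: filterS2 xE z0 => t -> /sqr_dist_maxr0; exact.
Qed.

Section projection.
Context {R : realType} {t0 tf : R} {P W : finType}.
Local Notation mu := (lebesgue_itv t0 tf).
Local Notation E := ({ffun P -> L2_itv t0 tf} * {ffun W -> R})%type.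
Implicit Types X Y Z : E.
Variable od : P -> W.

Lemma inner_E_sqr_dist X Y :
  inner_E (X - Y) (X - Y) =
  \sum_(p : P) \int[mu]_t (X.1 p t - Y.1 p t) ^+ 2
  + \sum_(w : W) (X.2 w - Y.2 w) ^+ 2.
Proof.
rewrite /inner_E; congr (_ + _); last first.
  by apply: eq_bigr => w _; rewrite /= !ffunE expr2.
apply: eq_bigr => p _; apply: ae_eq_Rintegral.
- have m := Lfun2_measurable (L2_fun_Lfun ((X - Y).1 p)).
  exact: measurable_funM.
- apply: measurable_funX; apply: measurable_funB.
    exact: Lfun2_measurable (L2_fun_Lfun (X.1 p)).
  exact: Lfun2_measurable (L2_fun_Lfun (Y.1 p)).
- apply: filterS (L2_funB (X.1 p) (Y.1 p)) => t.
  by rewrite /L2_itv_fun /= !ffunE => ->; rewrite expr2.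
Qed.

Lemma inner_E_sqr_dist_ge0 X Y : 0 <= inner_E (X - Y) (X - Y).
Proof.
rewrite inner_E_sqr_dist addr_ge0// sumr_ge0// => i _; rewrite ?sqr_ge0//.
by apply: Rintegral_ge0 => t _; exact: sqr_ge0.
Qed.

Lemma inner_E_sqr_dist_eq0 X Y : inner_E (X - Y) (X - Y) = 0 -> X = Y.
Proof.
have int0 p : 0 <= \int[mu]_t (X.1 p t - Y.1 p t) ^+ 2.
  by apply: Rintegral_ge0 => t _; exact: sqr_ge0.
rewrite inner_E_sqr_dist => /eqP.
rewrite paddr_eq0 ?sumr_ge0// => [|w _]; last exact: sqr_ge0.
rewrite !psumr_eq0// => [|w _]; last exact: sqr_ge0.
case: X Y int0 => [h Q] [h' Q'] /= _ /andP[/allP h0 /allP Q0].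
congr (_, _); apply/ffunP => i.
- by apply: Rintegral_sqr_sub_eq0; apply/eqP/h0; rewrite mem_index_enum.
- have := Q0 i; rewrite mem_index_enum => /(_ isT).
  by rewrite sqrf_eq0 => /eqP/subr0_eq.
Qed.

Lemma sum_paths (F : P -> R) : \sum_p F p = \sum_w \sum_(p in paths od w) F p.
Proof.
rewrite (partition_big od xpredT)//=; apply: eq_bigr => w _.
by apply: eq_bigl => p; rewrite inE.
Qed.

(** The points X that arise from Y by raising the path flows by the demand gap
    of their O-D pair and cutting off at 0; the first half of the system to be
    solved says that X is such a point. *)
Definition clipped Y X := forall p,
  {ae mu, forall t, X.1 p t = Num.max 0 (Y.1 p t + (Y.2 (od p) - X.2 (od p)))}.

(** Summing [L2_sqr_dist_maxr0] over the paths leaves a linear term in Z - X;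
    feasibility of X and Z turns it into one in the demands only, and this
    term cancels against the expansion of the squares (Y_w - Z_w)^2. *)
Lemma clipped_sqr_dist Y X Z :
  feasible od X -> clipped Y X -> feasible od Z ->
  inner_E (Y - X) (Y - X) + inner_E (Z - X) (Z - X) <= inner_E (Y - Z) (Y - Z).
Proof.
move=> [_ XQ] XE [Z0 ZQ]; rewrite !inner_E_sqr_dist.
have paths_le := ler_sum (index_enum P) (fun p (_ : xpredT p) =>
  L2_sqr_dist_maxr0 (@lebesgue_itv_finite _ t0 tf) (XE p) (Z0 p)).
rewrite !big_split /= in paths_le.
have cross : \sum_p 2 * (Y.2 (od p) - X.2 (od p)) *
      (\int[mu]_t Z.1 p t - \int[mu]_t X.1 p t) =
    \sum_w 2 * (Y.2 w - X.2 w) * (Z.2 w - X.2 w).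
  rewrite sum_paths; apply: eq_bigr => w _.
  rewrite -ZQ -[in Z in _ = _ * Z]XQ -sumrB mulr_sumr; apply: eq_bigr => p.
  by rewrite inE => /eqP ->.
have demand : \sum_w (Y.2 w - Z.2 w) ^+ 2 =
    \sum_w (Y.2 w - X.2 w) ^+ 2 + \sum_w (Z.2 w - X.2 w) ^+ 2
    - \sum_w 2 * (Y.2 w - X.2 w) * (Z.2 w - X.2 w).
  by rewrite -big_split -sumrB; apply: eq_bigr => w _ /=; ring.
rewrite demand -cross; move: paths_le; rewrite /L2_itv_fun; lra.
Qed.

(** A minimizer Z satisfies |Z - X|^2 <= |Y - Z|^2 - |Y - X|^2 <= 0. *)
Lemma proj_argmin_clipped Y X :
  feasible od X -> clipped Y X -> proj_argmin (feasible od) Y = [set X].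
Proof.
move=> fX cX; have dist := clipped_sqr_dist fX cX.
apply/seteqP; split => [Z [fZ Zmin]|_ ->] /=.
- apply: inner_E_sqr_dist_eq0; apply/eqP.
  rewrite eq_le inner_E_sqr_dist_ge0 andbT.
  have := Zmin _ fX; rewrite /norm_E ler_sqrt ?inner_E_sqr_dist_ge0//.
  move=> YZX; rewrite -(lerD2l (inner_E (Y - X) (Y - X))) addr0.
  by rewrite (le_trans (dist _ fZ)).
- split=> // Z fZ; rewrite /norm_E ler_wsqrtr//.
  by rewrite (le_trans _ (dist _ fZ))// lerDl inner_E_sqr_dist_ge0.
Qed.

End projection.

(** * The demand equation of an O-D pair *)

Section demand.
Context d (T : measurableType d) (R : realType) (P : finType).
Variable mu : {measure set T -> \bar R}.
Hypothesis mu_fin : fin_num_fun mu.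
Variables (A : {set P}) (g : P -> T -> R).
Hypothesis Lg : forall p, g p \in Lfun mu 2%:E.

(** The map whose fixed points are the new demands of the pair: A is its set of
    paths and g p stands for a_p + b_w. *)
Definition path_flow c := \sum_(p in A) \int[mu]_t Num.max 0 (g p t - c).

Lemma path_flow_nonincreasing : {homo path_flow : c e / c <= e >-> e <= c}.
Proof.
move=> c e ce; apply: ler_sum => p _.
exact: (Rintegral_excess_le mu_fin (Lg p) ce).
Qed.

Lemma path_flow_lipschitz c e :
  `|path_flow c - path_flow e| <= (\sum_(p in A) fine (mu setT)) * `|c - e|.
Proof.
rewrite -sumrB mulr_suml (le_trans (ler_norm_sum _ _ _))//.
by apply: ler_sum => p _; exact: Rintegral_excess_lipschitz.
Qed.

Lemma path_flow_fixpoint : exists c, path_flow c = c.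
Proof.
apply: exists_fixpoint_nonincreasing_lipschitz.
- by apply: sumr_ge0 => p _; apply: Rintegral_ge0 => t _; rewrite le_max lexx.
- exact: path_flow_nonincreasing.
- exact: path_flow_lipschitz.
Qed.

End demand.

(** * The projected step *)

Theorem theorem5p1 (R : realType) (t0 tf : R) (P W : finType) (od : P -> W)
    (Psi : {ffun P -> L2_itv t0 tf} -> {ffun P -> L2_itv t0 tf})
    (Theta : {ffun W -> R} -> {ffun W -> R})
    (alpha : R) (Xk : {ffun P -> L2_itv t0 tf} * {ffun W -> R})
    (ht : t0 < tf)
    (hPsi : set_fun L2_nneg L2_nneg Psi)
    (hTheta : set_fun [set Q : {ffun W -> R} | forall w, 0 <= Q w]
                      [set v : {ffun W -> R} | forall w, 0 < v w] Theta)
    (halpha : 0 < alpha)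
    (hXk : feasible od Xk) :
  exists Xk1 : {ffun P -> L2_itv t0 tf} * {ffun W -> R},
    [/\ proj_argmin (feasible od) (Xk - alpha *: F_E Psi Theta Xk) = [set Xk1],
        update_rel od Psi Theta alpha Xk Xk1 &
        forall Y, update_rel od Psi Theta alpha Xk Y -> Y = Xk1].
Proof.
case: Xk hXk => h Q _ /=.
have fin := @lebesgue_itv_finite R t0 tf.
pose g w p t := h p t - alpha * Psi h p t + Q w + alpha * Theta Q w.
have Lg w p : g w p \in Lfun (lebesgue_itv t0 tf) 2%:E.
  have -> : g w p = ((h p : R -> R) - alpha \o* Psi h p)
      - cst (- (Q w + alpha * Theta Q w)) :> (R -> R).
    apply/funext => t.
    rewrite -[RHS]/(h p t - Psi h p t * alpha - - (Q w + alpha * Theta Q w)).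
    by rewrite /g opprK addrA [_ * alpha]mulrC.
  apply: Lfun2_sub; last exact: Lfun2_cst.
  apply: Lfun2_sub; first exact: L2_fun_Lfun.
  by apply: Lfun_scale; [exact: ler1n|exact: L2_fun_Lfun].
have [q qE] : exists q : {ffun W -> R}, forall w,
    path_flow (lebesgue_itv t0 tf) (paths od w) (g w) (q w) = q w.
  have /choice[q qE] w := path_flow_fixpoint fin (paths od w) (Lg w).
  by exists [ffun w => q w] => w; rewrite ffunE.
have /choice[x xE] p :=
  exists_L2_fun (Lfun2_excess fin (q (od p)) (Lg (od p) p)).
pose X : {ffun P -> L2_itv t0 tf} * {ffun W -> R} := ([ffun p => x p], q).
have XE w p : p \in paths od w ->
    {ae lebesgue_itv t0 tf, forall t, X.1 p t = Num.max 0 (g w p t - q w)}.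
  by rewrite inE => /eqP <-; rewrite /= ffunE; exact: xE.
(* Placed in the context so that instance search finds it for [filterS]. *)
have aeF : Filter (nbhs (almost_everywhere (lebesgue_itv t0 tf))).
  exact: (ae_filter_ringOfSetsType (lebesgue_itv t0 tf)).
have own p : p \in paths od (od p) by rewrite inE.
have fX : feasible od X.
  split=> [p|w].
    by apply: filterS (XE _ p (own p)) => t ->; rewrite le_max lexx.
  rewrite -[RHS]qE; apply: eq_bigr => p pw; apply: ae_eq_Rintegral.
  - exact: Lfun2_measurable (L2_fun_Lfun (X.1 p)).
  - exact: Lfun2_measurable (Lfun2_excess fin _ (Lg w p)).
  - exact: XE.
exists X; split.
- apply: proj_argmin_clipped => // p.
  apply: filterS3 (XE _ _ (own p)) (L2_funB (h p) (alpha *: Psi h p))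
    (L2_funZ alpha (Psi h p)) => t -> Bt /(_ I) Zt.
  rewrite /= !ffunE; congr Num.max.
  have aE : (h p - alpha *: Psi h p) t = h p t - alpha * Psi h p t.
    by rewrite [LHS]Bt Zt.
  transitivity (h p t - alpha * Psi h p t
      + (Q (od p) - alpha * - Theta Q (od p) - q (od p))).
    by rewrite /g; ring.
  by congr (_ + _); exact: esym aE.
- split=> // w; exact: esym (qE w).
- case=> h' q' [h'E q'E].
  have qq : q' = q.
    apply/ffunP => w.
    exact: (fixpoint_nonincreasing_unique (path_flow_nonincreasing fin _ (Lg w))
      (esym (q'E w)) (qE w)).
  congr (_, _) => //; apply/ffunP => p; apply: L2_fun_inj.
  apply: filterS2 (h'E _ _ (own p)) (XE _ _ (own p)) => t h't Xt.
  by rewrite qq in h't; exact: etrans h't (esym Xt).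
Qed.
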